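(* Let $G$ be a left-orderable (finitely generated) group. If $G$ has a Dehornoy-like ordering having Property $F$ (i.e. one defined by an ordered finite generating set $\mathcal{S}$ of $G$ having Property $F$), then $G$ also has an isolated left ordering.
   Context: A left ordering of $G$ is a total order $<$ with $g<g' \Rightarrow hg<hg'$; its positive cone is $P=\{g\in G : 1<g\}$; $G$ is left-orderable if it has a left ordering. The set $\mathrm{LO}(G)$ of left orderings is topologized as a subspace of $2^{G-\{1\}}$ (product topology, $2$ discrete) by identifying an ordering with its positive cone. An isolated ordering is a left ordering that is an isolated point of $\mathrm{LO}(G)$. Let $\mathcal{S}=\{s_1,\dots,s_n\}$ be an ordered finite generating set of $G$. A word on $\mathcal{S}\cup\mathcal{S}^{-1}$ is $i$-positive if it contains at least one $s_i$ and contains none of $s_1^{\pm1},\dots,s_{i-1}^{\pm1},s_i^{-1}$. $\Sigma_{\mathcal{S}}$ is the set of elements represented by an $i$-positive word for some $1\le i\le n$. $\mathcal{S}$ defines a Dehornoy-like ordering if $\Sigma_{\mathcal{S}}$ is the positive cone of a left ordering of $G$; that ordering is then called Dehornoy-like. The twisted generating set of $\mathcal{S}$ is $\mathcal{A}=\{a_1,\dots,a_n\}$ with $a_i=(s_is_{i+1}\cdots s_n)^{(-1)^{n-i+1}}$. Let $P_{\mathcal{A}}^{(i)}$ be the set of elements represented by nonempty words in $a_i,\dots,a_n$ (no inverses). $\mathcal{S}$ has Property $F$ if for all $1\le i\le n-1$: $a_i\,(P_{\mathcal{A}}^{(i+1)})^{-1}a_i^{-1}\subset P_{\mathcal{A}}^{(i)}$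 and $a_i^{-1}(P_{\mathcal{A}}^{(i+1)})^{-1}a_i\subset P_{\mathcal{A}}^{(i)}$. *)

(* Defs.v *)
From HB Require Import structures.
From mathcomp Require Import all_boot.
From mathcomp Require Import boolp classical_sets topology.

Set Implicit Arguments.
Unset Strict Implicit.
Unset Printing Implicit Defensive.

Local Open Scope classical_set_scope.
Local Open Scope group_scope.

Definition left_ordering (G : groupType) (lt : rel G) : Prop :=
  [/\ irreflexive lt,
      transitive lt,
      forall g g' : G, [\/ g = g', lt g g' | lt g' g] &
      forall h g g' : G, lt g g' -> lt (h * g) (h * g')].

Definition left_orderable (G : groupType) : Prop :=
  exists lt : rel G, left_ordering lt.

Definition positive_cone (G : groupType) (lt : rel G) : set G :=
  [set g | lt 1 g].

(* The indicator function of the positive cone, as a point of 2^(G - {1}) with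
   the product topology; [bool] carries the discrete topology. *)
Definition cone_point (G : groupType) (lt : rel G) :
    {ptws {g : G | g != 1} -> bool} :=
  fun g => val g \in positive_cone lt.

Definition LO (G : groupType) : set {ptws {g : G | g != 1} -> bool} :=
  [set cone_point lt | lt in [set lt : rel G | left_ordering lt]].

Arguments LO : clear implicits.

Definition isolated_ordering (G : groupType) (lt : rel G) : Prop :=
  left_ordering lt /\ isolated (LO G) (cone_point lt).

(* An ordered generating set s_1, ..., s_n is a family indexed by
   'I_n = {0, ..., n-1}: s_i is [s] at the ordinal of value i - 1.
   The letter [(i, true)] stands for [s i] and [(i, false)] for [(s i)^-1]. *)
Definition word_val (G : groupType) (n : nat) (s : 'I_n -> G)
    (w : seq ('I_n * bool)) : G :=
  \prod_(x <- w) (if x.2 then s x.1 else (s x.1)^-1).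

Definition generating (G : groupType) (n : nat) (s : 'I_n -> G) : Prop :=
  forall g : G, exists w : seq ('I_n * bool), word_val s w = g.

Definition i_positive (n : nat) (i : 'I_n) (w : seq ('I_n * bool)) : Prop :=
  (i, true) \in w /\ forall x, x \in w -> (i <= x.1)%N /\ x <> (i, false).

Definition Sigma (G : groupType) (n : nat) (s : 'I_n -> G) : set G :=
  [set g | exists (i : 'I_n) (w : seq ('I_n * bool)),
             i_positive i w /\ word_val s w = g].

(* [lt] is the Dehornoy-like ordering defined by [s]. *)
Definition defines_Dehornoy_like (G : groupType) (n : nat) (s : 'I_n -> G)
    (lt : rel G) : Prop :=
  left_ordering lt /\ positive_cone lt = Sigma s.

(* a_i = (s_i s_{i+1} ... s_n)^((-1)^(n - i + 1)); since [i : 'I_n] has value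
   one less than the 1-based index, the exponent is (-1)^(n - i) here. *)
Definition twisted (G : groupType) (n : nat) (s : 'I_n -> G) (i : 'I_n) : G :=
  let p := \prod_(j < n | (i <= j)%N) s j in
  if odd (n - i) then p^-1 else p.

Definition twisted_semigroup (G : groupType) (n : nat) (s : 'I_n -> G) (i : nat) :
    set G :=
  [set g | exists w : seq 'I_n,
     [/\ w <> [::], forall j, j \in w -> (i <= j)%N &
         \prod_(j <- w) twisted s j = g]].

Definition property_F (G : groupType) (n : nat) (s : 'I_n -> G) : Prop :=
  forall i : 'I_n, (i.+1 < n)%N ->
    let a := twisted s i in
    [set a * p^-1 * a^-1 | p in twisted_semigroup s i.+1]
      `<=` twisted_semigroup s i /\
    [set a^-1 * p^-1 * a | p in twisted_semigroup s i.+1]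
      `<=` twisted_semigroup s i.

(* Main.v *)
Require Import Defs.
From mathcomp Require Import all_boot.
From mathcomp Require Import boolp classical_sets filter topology.

(** The isolated ordering is the one whose positive cone is the semigroup T_0
generated by the twisted generators a_i, where T_k denotes the semigroup
generated by a_k, a_{k+1}, ... (indices start at 0). An ordering with a finitely
generated positive cone is isolated: positivity of the generators is a basic
open condition, it forces another cone to contain the given one, and nested
positive cones are equal ([finitely_generated_cone_isolated]).

Write H_k for the subgroup generated by s_k, s_{k+1}, ..., and p_i for the
product s_i s_{i+1} ... , so that a_i is p_i or its inverse, with a sign
depending only on i. Two facts make T_0 a positive cone.

It does not contain 1. In a word in the a_j whose least index is i, every a_i
has the same sign and the other letters lie in H_{i+1}; hence the word, up to
inversion, is an i-positive element of G, and i-positive elements are positive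
for the Dehornoy-like ordering.

It contains each nontrivial element or its inverse. As the Dehornoy-like ordering
is total, it is enough that i-positive elements be in T_i up to inversion, and
s_i is p_i times an element of H_{i+1}, so an i-positive element is, up to
inversion, a product of factors h a_i h' with h, h' in H_{i+1}. By downward
induction h and h' are each trivial, in T_{i+1} or in its inverse. Property F
says exactly that the conjugates of a negative h by a_i and by its inverse lie
in T_i, so h a_i and a_i h both lie in T_i; [tail_twisted_tail] extends this to
two-sided factors. *)

Set Implicit Arguments.
Unset Strict Implicit.
Unset Printing Implicit Defensive.

Local Open Scope classical_set_scope.
Local Open Scope group_scope.

(** * Left orderings, positive cones and isolated points *)

Section Orderings.
Variable G : groupType.
Implicit Types (lt : rel G) (P : set G) (g h : G).

Lemma left_ordering_of_cone P :
    ~ P 1 -> (forall g h, P g -> P h -> P (g * h)) ->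
    (forall g, [\/ g = 1, P g | P g^-1]) ->
  left_ordering (fun g h => `[< P (g^-1 * h) >]).
Proof.
move=> P1 PM Ptri; split.
- by move=> g; rewrite mulVg; apply/asboolP.
- move=> h g k /asboolP Pgh /asboolP Phk; apply/asboolP.
  by rewrite -(mulKg h k) mulKg -[g^-1](mulgK h) -mulgA; apply: PM.
- move=> g g'; have [/(canRL (mulKg _)) e|Pg|Pg] := Ptri (g^-1 * g').
  + by apply: Or31; rewrite e invgK mulg1.
  + by apply: Or32; apply/asboolP.
  + by apply: Or33; apply/asboolP; rewrite invgM invgK in Pg.
- by move=> h g g' /asboolP Pg; apply/asboolP; rewrite invgM mulgA mulgVK.
Qed.

Lemma cone_mul lt g h : left_ordering lt -> lt 1 g -> lt 1 h -> lt 1 (g * h).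
Proof.
move=> [_ ltT _ ltM] lt1g lt1h; apply: (ltT g) => //.
by rewrite -{1}[g]mulg1; apply: ltM.
Qed.

Lemma cone_inv lt g : left_ordering lt -> lt 1 g -> ~ lt 1 g^-1.
Proof.
move=> lo lt1g lt1g'; have := cone_mul lo lt1g lt1g'.
by rewrite mulgV; case: lo => ->.
Qed.

(** Totality makes every positive cone maximal: a nontrivial element left out has
    its inverse in it. *)
Lemma cone_maximal lt lt' :
    left_ordering lt -> left_ordering lt' ->
    (forall g, lt 1 g -> lt' 1 g) -> forall g, lt' 1 g = lt 1 g.
Proof.
move=> lo lo' sub g; apply/idP/idP => [lt'g|]; last exact: sub.
have [_ _ tot ltM] := lo; case: (tot 1 g) => // [g1|ltg1].
  by move: lt'g; rewrite -g1; case: lo' => ->.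
have /sub : lt 1 g^-1 by rewrite -(mulVg g) -[g^-1 in X in lt _ X]mulg1; apply: ltM.
by move/(cone_inv lo' lt'g).
Qed.

(** The finitely many conditions that the generators be positive cut out an
    open set, and [cone_maximal] leaves no other ordering in it. *)
Lemma finitely_generated_cone_isolated lt (I : finType) (a : I -> G) :
    left_ordering lt -> (forall i, lt 1 (a i)) ->
    (forall g, lt 1 g -> exists2 w : seq I, w <> [::] & \prod_(i <- w) a i = g) ->
  isolated_ordering lt.
Proof.
move=> lo a_pos gen; split => //; split.
  by apply/mem_set; exists lt.
have an1 i : a i != 1.
  by apply/eqP => ai1; have := a_pos i; rewrite ai1; case: lo => ->.
(* Points of the product space are functions on G - {1}. *)
pose x i : {g : G | g != 1} := exist _ (a i) (an1 i).
exists [set f : {ptws {g : G | g != 1} -> bool} | forall i, f (x i) = true].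
  apply: (@filter_forall _ I (fun i => [set f : {ptws {g : G | g != 1} -> bool} |
    f (x i) = true]) (nbhs (cone_point lt : {ptws {g : G | g != 1} -> bool}))) => i.
  have fx : nbhs (cone_point lt (x i)) [set true].
    have -> : cone_point lt (x i) = true by apply/mem_set; exact: a_pos.
    exact: discrete_set1.
  exact: (@proj_continuous _ (fun=> bool : topologicalType) (x i) (cone_point lt) _ fx).
apply/seteqP; split => [f [/= Vf [lt' /= lo' lt'f]]|f /= ->]; last first.
  by split => [i|]; [apply/mem_set; exact: a_pos|exists lt].
have lt'a i : lt' 1 (a i) by have := Vf i; rewrite -lt'f => /set_mem.
have sub g : lt 1 g -> lt' 1 g.
  move=> /gen[w + <-]; elim: w => // i [_|j w IH] _.
    by rewrite big_seq1.
  by rewrite big_cons; apply: cone_mul => //; apply: IH.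
rewrite /= -lt'f; apply: functional_extensionality_dep => g.
rewrite /cone_point; congr (_ \in _).
by apply/funext => h; rewrite /positive_cone/= (cone_maximal lo lo' sub).
Qed.

End Orderings.

(** * Elements represented by i-positive words *)

Section TwistedCone.
Variables (G : groupType) (n : nat) (s : 'I_n -> G).
Implicit Types (i j : 'I_n) (k : nat) (g h : G).

Lemma word_val_cat w w' : word_val s (w ++ w') = word_val s w * word_val s w'.
Proof. by rewrite /word_val big_cat. Qed.

Lemma word_val_cons x w :
  word_val s (x :: w) = (if x.2 then s x.1 else (s x.1)^-1) * word_val s w.
Proof. by rewrite /word_val big_cons. Qed.

Definition tail_group k : set G :=
  [set g | exists2 w : seq ('I_n * bool),
     (forall x, x \in w -> (k <= x.1)%N) & word_val s w = g].

Lemma tail_group1 k : tail_group k 1.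
Proof. by exists [::] => //; rewrite /word_val big_nil. Qed.

Lemma tail_groupM k g h : tail_group k g -> tail_group k h -> tail_group k (g * h).
Proof.
move=> [w wk <-] [v vk <-]; exists (w ++ v); last exact: word_val_cat.
by move=> x; rewrite mem_cat => /orP[/wk|/vk].
Qed.

Lemma tail_group_gen k i : (k <= i)%N -> tail_group k (s i).
Proof.
by move=> ki; exists [:: (i, true)]; rewrite /word_val ?big_seq1 // => x;
  rewrite inE => /eqP ->.
Qed.

Lemma tail_groupV k g : tail_group k g -> tail_group k g^-1.
Proof.
move=> [w + <-]; elim: w => [_|x w IH wk].
  by rewrite /word_val big_nil invg1; apply: tail_group1.
rewrite word_val_cons invgM; apply: tail_groupM.
  by apply: IH => y yw; apply: wk; rewrite inE yw orbT.
exists [:: (x.1, ~~ x.2)].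
  by move=> y; rewrite inE => /eqP -> /=; apply: wk; rewrite inE eqxx.
by rewrite /word_val big_seq1 /=; case: x.2 => //=; rewrite invgK.
Qed.

Lemma tail_groupS k l g : (k <= l)%N -> tail_group l g -> tail_group k g.
Proof. by move=> kl [w wl <-]; exists w => // x /wl; apply: leq_trans. Qed.

Definition positive_part i : set G :=
  [set g | exists2 w, i_positive i w & word_val s w = g].

Lemma positive_partM i g h :
  positive_part i g -> positive_part i h -> positive_part i (g * h).
Proof.
move=> [w [iw wi] <-] [v [_ vi] <-]; exists (w ++ v); last exact: word_val_cat.
split=> [|x]; first by rewrite mem_cat iw.
by rewrite mem_cat => /orP[/wi|/vi].
Qed.

Lemma positive_part_tail i g : positive_part i g -> tail_group i g.
Proof. by move=> [w [_ wi] <-]; exists w => // x /wi[]. Qed.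

Lemma tail_positive_part i h g h' :
    tail_group i.+1 h -> tail_group i.+1 h' -> positive_part i g ->
  positive_part i (h * g * h').
Proof.
move=> [u ui <-] [v vi <-] [w [iw wi] <-]; exists (u ++ w ++ v); last first.
  by rewrite !word_val_cat mulgA.
split=> [|x]; first by rewrite !mem_cat iw orbT.
rewrite !mem_cat => /or3P[/ui ix|/wi//|/vi ix].
  by split=> [|e]; [exact: ltnW|rewrite e ltnn in ix].
by split=> [|e]; [exact: ltnW|rewrite e ltnn in ix].
Qed.

Lemma positive_part_gen i : positive_part i (s i).
Proof.
exists [:: (i, true)]; last by rewrite /word_val big_seq1.
by split=> [|x]; rewrite inE // => /eqP ->.
Qed.

(** An i-positive word can be cut into pieces with one occurrence of the letter
    s_i each, so i-positive elements form the semigroup generated by the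
    elements h s_i h' with h and h' in the subgroup of the later generators. *)
Lemma positive_part_ind i (Q : set G) :
    (forall h h', tail_group i.+1 h -> tail_group i.+1 h' -> Q (h * s i * h')) ->
    (forall g g', Q g -> Q g' -> Q (g * g')) ->
  positive_part i `<=` Q.
Proof.
move=> Qs QM _ [w [iw wi] <-].
have t1 := tail_group1 i.+1.
(* The element h collects the letters other than s_i read since the last s_i;
   a word without any s_i has no piece to attach them to. *)
suff key h : tail_group i.+1 h ->
    if (i, true) \in w then Q (h * word_val s w) else tail_group i.+1 (h * word_val s w).
  by have := key 1 t1; rewrite iw mul1g.
elim: w h wi {iw} => [|x w IH] h wi hi; first by rewrite /word_val big_nil mulg1.
have {}IH := IH _ (fun y yw => wi y (mem_behead (s := x :: w) yw)).
rewrite word_val_cons inE; have [<-|/eqP xi] /= := eqVneq.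
  have := IH 1 t1; rewrite mul1g mulgA; case: ifP => _ wQ; last exact: Qs.
  by apply: QM => //; rewrite -[_ * _]mulg1; apply: Qs.
rewrite mulgA; apply: IH; apply: tail_groupM => //.
have := wi x (mem_head x w); case: x xi {wi} => j b /= xi [+ jb].
rewrite leq_eqVlt => /predU1P[/val_inj ij|ij].
  by move: xi jb; rewrite ij; case: b.
by case: b {xi jb}; [|apply: tail_groupV]; apply: tail_group_gen.
Qed.

(** * Twisted generators and their signs *)

Definition tail_prod k : G := \prod_(j < n | (k <= j)%N) s j.

Lemma tail_prod_in k : tail_group k (tail_prod k).
Proof.
rewrite /tail_prod; elim/big_rec: _ => [|i g ki]; first exact: tail_group1.
by apply: tail_groupM; apply: tail_group_gen.
Qed.

(** The product is over all ordinals with a filter, in a noncommutative monoid,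
    so its first factor is exposed by passing to an interval of integers. *)
Lemma tail_prodS i : tail_prod i = s i * tail_prod i.+1.
Proof.
pose s' m := if insub m is Some j then s j else 1.
have tailE k : tail_prod k = \prod_(k <= m < n) s' m.
  by rewrite big_geq_mkord; apply: eq_bigr => j _; rewrite /s' valK.
by rewrite !tailE big_ltn // /s' valK.
Qed.

(** The sign carried by [twisted s i], separated from the product it applies to. *)
Definition twist i g : G := if odd (n - i) then g^-1 else g.

Lemma twistK i : involutive (twist i).
Proof. by move=> g; rewrite /twist; case: odd; rewrite ?invgK. Qed.

Lemma twisted_tail_prod i : twist i (twisted s i) = tail_prod i.
Proof. exact: twistK. Qed.

Lemma twist_closedM i (P : set G) g h :
    (forall x y, P x -> P y -> P (x * y)) ->
  P (twist i g) -> P (twist i h) -> P (twist i (g * h)).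
Proof.
by move=> PM; rewrite /twist; case: odd => Pg Ph; rewrite ?invgM; apply: PM.
Qed.

Lemma positive_part_tail_prod i : positive_part i (tail_prod i).
Proof.
rewrite tail_prodS -[s i]mul1g; apply: tail_positive_part.
- exact: tail_group1.
- exact: tail_prod_in.
- exact: positive_part_gen.
Qed.

(** The semigroup of i-positive elements or, for the indices at which the twist
    inverts, of their inverses: the side on which [twisted s i] lies. *)
Definition twisted_part i : set G := [set g | positive_part i (twist i g)].

Lemma twisted_partM i g h :
  twisted_part i g -> twisted_part i h -> twisted_part i (g * h).
Proof. by apply: twist_closedM; apply: positive_partM. Qed.

Lemma tail_twisted_part i h g h' :
    tail_group i.+1 h -> tail_group i.+1 h' -> twisted_part i g ->
  twisted_part i (h * g * h').
Proof.
rewrite /twisted_part /twist /=; case: odd; last exact: tail_positive_part.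
by rewrite !invgM mulgA => ? ? ?; apply: tail_positive_part => //; apply: tail_groupV.
Qed.

Lemma twisted_part_twisted i : twisted_part i (twisted s i).
Proof. rewrite /twisted_part /= twisted_tail_prod; exact: positive_part_tail_prod. Qed.

Lemma twisted_in_tail k i : (k <= i)%N -> tail_group k (twisted s i).
Proof.
move=> ki; apply: (tail_groupS ki); rewrite -[twisted s i](twistK i).
rewrite twisted_tail_prod /twist.
by case: odd; [apply: tail_groupV|]; apply: tail_prod_in.
Qed.

Lemma twisted_part_tail k i g : (k <= i)%N -> twisted_part i g -> tail_group k g.
Proof.
move=> ki /positive_part_tail; rewrite /twist => gi; apply: (tail_groupS ki).
by move: gi; case: odd => // /tail_groupV; rewrite invgK.
Qed.

(** The index is the least one occurring in the word: all its occurrences carry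
    the same sign, and letters of larger index are absorbed. *)
Lemma twisted_semigroup_part k g :
  twisted_semigroup s k g -> exists i, twisted_part i g.
Proof.
move=> [w [+ _ <-]]; elim: w => // j w IH _; rewrite big_cons.
have [->|/eqP w0] := eqVneq w [::].
  by exists j; rewrite big_nil mulg1; apply: twisted_part_twisted.
have [i gi] := IH w0; set g' := \prod_(_ <- w) _ in gi *.
have gj := twisted_part_twisted j.
case: (ltngtP i j) => [ij|ji|/val_inj ij].
- exists i; rewrite -[_ * g']mulg1; apply: tail_twisted_part => //.
    exact: twisted_in_tail.
  exact: tail_group1.
- exists j; rewrite -[_ * g']mul1g mulgA; apply: tail_twisted_part => //.
    exact: tail_group1.
  exact: twisted_part_tail gi.
- by exists i; apply: twisted_partM => //; rewrite ij.
Qed.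

Lemma twisted_semigroup_gen k i : (k <= i)%N -> twisted_semigroup s k (twisted s i).
Proof.
move=> ki; exists [:: i]; split=> //; last by rewrite big_seq1.
by move=> j; rewrite inE => /eqP ->.
Qed.

Lemma twisted_semigroupM k g h :
  twisted_semigroup s k g -> twisted_semigroup s k h -> twisted_semigroup s k (g * h).
Proof.
move=> [w [w0 wk <-]] [v [v0 vk <-]]; exists (w ++ v); split.
- by case: w w0 {wk}.
- by move=> j; rewrite mem_cat => /orP[/wk|/vk].
- by rewrite big_cat.
Qed.

Lemma twisted_semigroupS k l g :
  (k <= l)%N -> twisted_semigroup s l g -> twisted_semigroup s k g.
Proof.
by move=> kl [w [w0 wl <-]]; exists w; split=> // j /wl; apply: leq_trans.
Qed.

Lemma twisted_semigroup_lt k g : twisted_semigroup s k g -> (k < n)%N.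
Proof.
move=> [[|j w] [// _ wk _]]; apply: leq_ltn_trans (wk j _) (ltn_ord j).
by rewrite inE eqxx.
Qed.

(** * Property F and two-sided absorption *)

Hypothesis F : property_F s.

Section Step.
Variable i : 'I_n.
Let a := twisted s i.
Let T := twisted_semigroup s i.

(* The induction hypothesis of [tail_trichotomy]. *)
Hypothesis tri : forall h, tail_group i.+1 h ->
  [\/ h = 1, twisted_semigroup s i.+1 h | twisted_semigroup s i.+1 h^-1].

(** Property F is needed when h is negative: h a = a (a^-1 h a), where the
    conjugate is in T; symmetrically for a h. *)
Lemma twisted_absorbs h : tail_group i.+1 h -> T (h * a) /\ T (a * h).
Proof.
have Ta : T a by apply: twisted_semigroup_gen.
move/tri => [->|hp|hn]; first by rewrite mul1g mulg1.
  by have Th := twisted_semigroupS (leqnSn i) hp; split; apply: twisted_semigroupM.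
have [Fl Fr] := F (twisted_semigroup_lt hn).
split.
- rewrite -[h * a](mulVKg a); apply: twisted_semigroupM => //.
  by apply: Fr; exists h^-1 => //; rewrite invgK mulgA.
- rewrite -[a * h](mulgVK a); apply: twisted_semigroupM => //.
  by apply: Fl; exists h^-1 => //; rewrite invgK.
Qed.

(** Letters of index above i can be moved into h, up to the first occurrence of
    a in the word or, failing that, the final a; there [twisted_absorbs]
    applies. *)
Lemma twisted_absorbs_word (w : seq 'I_n) h :
    (forall j, j \in w -> (i <= j)%N) -> tail_group i.+1 h ->
  T (h * \prod_(j <- w) twisted s j * a).
Proof.
elim: w h => [|j w IH] h wi hi.
  by rewrite big_nil mulg1; apply: (twisted_absorbs hi).1.
have {}IH := IH _ (fun l lw => wi l (mem_behead (s := j :: w) lw)).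
rewrite big_cons !mulgA.
have := wi j (mem_head j w); rewrite leq_eqVlt => /predU1P[/val_inj ij|ij].
  rewrite -ij -(mulgA (h * _)); apply: twisted_semigroupM.
    exact: (twisted_absorbs hi).1.
  by rewrite -[\prod_(_ <- _) _]mul1g; apply: IH; apply: tail_group1.
by apply: IH; apply: tail_groupM => //; apply: twisted_in_tail.
Qed.

(** When h' is negative, Property F rewrites a h' as u a with u in T. This u may
    be a word without any a, which a negative h could cancel, so h u cannot be
    handled apart from the final a: hence [twisted_absorbs_word]. *)
Lemma tail_twisted_tail h h' :
  tail_group i.+1 h -> tail_group i.+1 h' -> T (h * a * h').
Proof.
move=> hi h'i; have [[->|h'p|h'n] [Tha _]] := (tri h'i, twisted_absorbs hi).
- by rewrite mulg1.
- by apply: twisted_semigroupM => //; apply: twisted_semigroupS h'p.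
have [Fl _] := F (twisted_semigroup_lt h'n).
have [|w [_ wi we]] := Fl (a * h' * a^-1).
  by exists h'^-1 => //; rewrite invgK.
have -> : h * a * h' = h * (a * h' * a^-1) * a by rewrite !mulgA mulgVK.
by rewrite -we; apply: twisted_absorbs_word.
Qed.

Lemma positive_part_twist : positive_part i `<=` [set g | T (twist i g)].
Proof.
apply: positive_part_ind => [h h' hi h'i|g h] /=; last first.
  by apply: twist_closedM; apply: twisted_semigroupM.
(* With s_i = p_i q^-1, where q involves only later generators, the piece
   becomes one around p_i, that is, around a or its inverse. *)
set q := tail_prod i.+1.
have -> : h * s i * h' = h * tail_prod i * (q^-1 * h').
  by rewrite tail_prodS !mulgA mulgK.
have {h'i} : tail_group i.+1 (q^-1 * h').
  by apply: tail_groupM => //; apply: tail_groupV; apply: tail_prod_in.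
move: (q^-1 * h') => {}h' h'i; rewrite -twisted_tail_prod /twist.
case: odd; last exact: tail_twisted_tail.
by rewrite !invgM invgK mulgA; apply: tail_twisted_tail; apply: tail_groupV.
Qed.

End Step.

(** * The positive cone generated by the twisted generators *)

Variable lt : rel G.
Hypothesis Dlt : defines_Dehornoy_like s lt.

Lemma positive_part_pos i g : positive_part i g -> lt 1 g.
Proof.
case: Dlt => _ e [w wi wg].
by rewrite -[is_true _]/(positive_cone lt g) e; exists i, w.
Qed.

Lemma pos_positive_part g : lt 1 g -> exists i, positive_part i g.
Proof.
case: Dlt => _ e; rewrite -[is_true _]/(positive_cone lt g) e.
by move=> [i [w [wi wg]]]; exists i, w.
Qed.

(** If i were smaller than k, multiplying an i-positive word for g by a word for
    g^-1 in generators of index above i would give an i-positive word for 1. *)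
Lemma tail_positive_part_index k i g :
  tail_group k g -> positive_part i g -> (k <= i)%N.
Proof.
move=> gk gi; rewrite leqNgt; apply/negP => ik.
have : positive_part i (1 * g * g^-1).
  apply: tail_positive_part => //; first exact: tail_group1.
  by apply: tail_groupV; apply: tail_groupS gk.
rewrite mul1g mulgV => /positive_part_pos.
by case: Dlt => -[->].
Qed.

(** Downward induction on k. An element of the k-th tail subgroup is, up to
    inversion, i-positive with i at least k, and the case of i + 1 gives
    the trichotomy that [positive_part_twist] asks for. *)
Lemma tail_trichotomy k g : tail_group k g ->
  [\/ g = 1, twisted_semigroup s k g | twisted_semigroup s k g^-1].
Proof.
have [m le_m] := ubnP (n - k); elim: m => // m IH in k g le_m *.
have pos x : tail_group k x -> lt 1 x ->
    twisted_semigroup s k x \/ twisted_semigroup s k x^-1.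
  move=> xk /pos_positive_part[i xi].
  have ki := tail_positive_part_index xk xi.
  have tri h : tail_group i.+1 h ->
    [\/ h = 1, twisted_semigroup s i.+1 h | twisted_semigroup s i.+1 h^-1].
    apply: IH; apply: (leq_trans (n := n - k)); last by rewrite -ltnS.
    by apply: ltn_sub2l => //; apply: leq_ltn_trans ki (ltn_ord i).
  have := positive_part_twist tri xi; rewrite /= /twist.
  by case: odd => /(twisted_semigroupS ki); [right|left].
move=> gk; case: (Dlt) => -[_ _ tot ltM] _.
have [<-|/(pos g gk)[]|g1] := tot 1 g; [exact: Or31|exact: Or32|exact: Or33|].
have /(pos _ (tail_groupV gk)) : lt 1 g^-1.
  by rewrite -(mulVg g) -[g^-1 in X in lt _ X]mulg1; apply: ltM.
by rewrite invgK => -[]; [exact: Or33|exact: Or32].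
Qed.

Lemma twisted_semigroup_neq1 k : ~ twisted_semigroup s k 1.
Proof.
move=> /twisted_semigroup_part[i]; rewrite /twisted_part /twist /= invg1 if_same.
by move/positive_part_pos; case: Dlt => -[->].
Qed.

Lemma twisted_isolated (gen : generating s) :
  isolated_ordering (fun g h => `[< twisted_semigroup s 0 (g^-1 * h) >]).
Proof.
apply: (@finitely_generated_cone_isolated _ _ 'I_n (twisted s)).
- apply: left_ordering_of_cone => [|g h|g].
  + exact: twisted_semigroup_neq1.
  + exact: twisted_semigroupM.
  + by apply: tail_trichotomy; have [w <-] := gen g; exists w.
- by move=> i; apply/asboolP; rewrite invg1 mul1g; apply: twisted_semigroup_gen.
- by move=> g /asboolP; rewrite invg1 mul1g => -[w [w0 _ <-]]; exists w.
Qed.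

End TwistedCone.

Theorem corollary1 (G : groupType) (hG : left_orderable G)
    (hD : exists (n : nat) (s : 'I_n -> G) (lt : rel G),
        [/\ generating s, defines_Dehornoy_like s lt & property_F s]) :
  exists lt : rel G, isolated_ordering lt.
Proof.
have [n [s [lt [gen Dlt F]]]] := hD.
by eexists; exact: (twisted_isolated F Dlt gen).
Qed.
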